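(* Let $f\in\{0,1\}^n$. Suppose that at least one of the four words $f$, $f^{rev}$, $\overline{f}$, $\overline{f}^{\,rev}$ satisfies at least one of the following conditions. Then $f$ is tilde-non-isometric. (1) It has a $2$-tilde-error overlap whose error positions are not adjacent. (2) It has a $2$-tilde-error overlap of type SS with adjacent error positions. (3) There exist words $w_1,w_2,w_3,w_4$ with $w_1$ nonempty such that it equals $w_2\,101\,w_3w_4=w_1w_2\,010\,w_3$. This is a $2$-tilde-error overlap with error block $101$, of type SR or RS. (4) There exist words $x,y,z$ such that it equals $x\,1001\,z=y\,x\,011$. (5) It begins with $110$ and ends with $100$. In this case $\mathrm{pre}_2=11$ and $\mathrm{suf}_2=00$, giving a $2$-tilde-error overlap of type RR.
   Context: Words are over $\{0,1\}$. $f^{rev}$ is the reverse of $f$ and $\overline{f}$ its complement (each symbol flipped). For $w$ of length $n$: $\mathrm{pre}_l(w)=w[1..l]$ and $\mathrm{suf}_l(w)=w[n-l+1..n]$. A word is $f$-free if it does not contain $f$ as a factor. Operations: the replacement $R_i$ flips the symbol at position $i$ and modifies position $i$. The swap $S_i$ is defined when $w[i]\ne w[i+1]$, exchanges these two symbols, and modifies positions $i,i+1$. $\mathrm{dist}_\sim(u,v)$ is the minimum number of replacements and swaps transforming $u$ into the equal-length word $v$. A tilde-transformation from $u$ to $v$ is a sequence of words from $u$ to $v$, each obtained from the previous by one operation. It is minimal if it uses exactly $\mathrm{dist}_\sim(u,v)$ operations and each position is modified by at most one operation. $f$ is tilde-isometric if, for every $m>n$ and all $f$-free $u,v\in\{0,1\}^m$,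 there is a minimal tilde-transformation from $u$ to $v$ all of whose words are $f$-free. Otherwise it is tilde-non-isometric. $f$ has a $2$-tilde-error overlap of length $l$ (with $1\le l\le n-1$) if $\mathrm{dist}_\sim(\mathrm{pre}_l(f),\mathrm{suf}_l(f))=2$. Fix a minimal tilde-transformation from $\mathrm{pre}_l(f)$ to $\mathrm{suf}_l(f)$. Its two operations $O_i\in\{R_i,S_i\}$ and $O_j\in\{R_j,S_j\}$ act at positions $i<j$ (the error positions). The type is RR, SR, RS or SS according to whether $(O_i,O_j)$ is (replacement, replacement), (swap, replacement), (replacement, swap) or (swap, swap). The error positions are adjacent if $j=i+1$ when $O_i$ is a replacement (types RR, RS), and if $j=i+2$ when $O_i$ is a swap (types SR, SS). *)

(* Defs.v *)
(* Binary words are [seq bool]: 1 = true, 0 = false.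
   Positions are 0-indexed internally (the paper uses 1-indexed positions;
   all conditions used below are invariant under this shift). *)
From mathcomp Require Import all_boot.
Set Implicit Arguments. Unset Strict Implicit. Unset Printing Implicit Defensive.

Definition word := seq bool.

Definition wrev (w : word) : word := rev w.
Definition wcompl (w : word) : word := map negb w.

Definition pre (l : nat) (w : word) : word := take l w.
Definition suf (l : nat) (w : word) : word := drop (size w - l) w.

Definition ffree (f w : word) : bool := ~~ infix f w.

Inductive op := Rep of nat | Swp of nat.

Definition op_pos (o : op) : nat := match o with Rep i => i | Swp i => i end.
Definition is_swap (o : op) : bool := if o is Swp _ then true else false.

Definition modified (o : op) : seq nat :=
  match o with Rep i => [:: i] | Swp i => [:: i; i.+1] end.

Definition apply_op (w : word) (o : op) : option word :=
  match o with
  | Rep i => if i < size w then Some (set_nth false w i (~~ nth false w i))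
             else None
  | Swp i => if (i.+1 < size w) && (nth false w i != nth false w i.+1) then
               Some (set_nth false (set_nth false w i (nth false w i.+1))
                       i.+1 (nth false w i))
             else None
  end.

Fixpoint run (w : word) (ops : seq op) : option word :=
  match ops with
  | [::] => Some w
  | o :: os => match apply_op w o with Some w' => run w' os | None => None end
  end.

Fixpoint trace (w : word) (ops : seq op) : seq word :=
  w :: match ops with
       | [::] => [::]
       | o :: os => match apply_op w o with
                    | Some w' => trace w' os | None => [::] end
       end.

Definition tilde_trans (u v : word) (ops : seq op) : Prop := run u ops = Some v.

Definition tdist (u v : word) (d : nat) : Prop :=
  (exists ops, tilde_trans u v ops /\ size ops = d) /\
  (forall ops, tilde_trans u v ops -> d <= size ops).

Definition minimal_trans (u v : word) (ops : seq op) : Prop :=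
  [/\ tilde_trans u v ops, tdist u v (size ops) &
      uniq (flatten (map modified ops))].

Definition tilde_isometric (f : word) : Prop :=
  forall m, size f < m ->
  forall u v : word, size u = m -> size v = m -> ffree f u -> ffree f v ->
  exists ops, minimal_trans u v ops /\ all (ffree f) (trace u ops).

Definition sort2 (a b : op) : op * op :=
  if op_pos a < op_pos b then (a, b) else (b, a).

Definition adjacent (oi oj : op) : bool :=
  if is_swap oi then op_pos oj == (op_pos oi).+2 else op_pos oj == (op_pos oi).+1.

Definition has_overlap2 (g : word) (P : op -> op -> bool) : Prop :=
  exists l a b, [/\ 1 <= l, l <= size g - 1,
    tdist (pre l g) (suf l g) 2,
    minimal_trans (pre l g) (suf l g) [:: a; b] &
    P (sort2 a b).1 (sort2 a b).2].

Definition cond1 (g : word) : Prop :=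
  has_overlap2 g (fun oi oj => ~~ adjacent oi oj).
Definition cond2 (g : word) : Prop :=
  has_overlap2 g (fun oi oj => [&& is_swap oi, is_swap oj & adjacent oi oj]).
Definition cond3 (g : word) : Prop :=
  exists w1 w2 w3 w4 : word, w1 != [::] /\
    g = w2 ++ [:: true; false; true] ++ w3 ++ w4 /\
    g = w1 ++ w2 ++ [:: false; true; false] ++ w3.
Definition cond4 (g : word) : Prop :=
  exists x y z : word,
    g = x ++ [:: true; false; false; true] ++ z /\
    g = y ++ x ++ [:: false; true; true].
Definition cond5 (g : word) : Prop :=
  prefix [:: true; true; false] g /\ suffix [:: true; false; false] g.

Definition some_cond (g : word) : Prop :=
  cond1 g \/ cond2 g \/ cond3 g \/ cond4 g \/ cond5 g.

(* Main.v *)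
Require Import Defs.
From mathcomp Require Import all_boot zify.
Set Implicit Arguments. Unset Strict Implicit. Unset Printing Implicit Defensive.

(* Let [f] have an overlap with shift [r] and errors [E_i], [E_j] (blocks of one
   or two positions), and let [W] be [f] preceded by its first [r] letters.
   Flipping [E_i], respectively [E_j], in the second occurrence of the overlap in
   [W] gives words [u] and [v].  The two orders of performing the operations
   leading from [u] to [v] pass through [W], which ends with [f], or through [W]
   with both blocks flipped, which begins with [f].  Hence [f] is not isometric
   as soon as [u] and [v] are [f]-free.  Comparing a third occurrence of [f],
   shifted by [p], with the two near-occurrences at [0] and [r] shows that this
   can only fail when the two errors have the same type, [r = 2s] with
   [s = j - i], and [f] is [s]-periodic except for one defect.  Such an [f] has
   another 2-error overlap with shift a larger multiple of [s], for which [u] and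
   [v] are [f]-free, unless it reads [aabb] along the defective residue class; then
   the words reading [aababbb] and [aaababb] there, at distance three, work.
   Conditions (4) and (5) are settled by the pairs [yx0101z], [yx1010z] and
   [L1010R], [L0101R] with [f = L100 = 110R]. *)

(** * Blocks of positions, occurrences, and operations as block flips *)

Definition ind (p e k : nat) : bool := p <= k < p + e.

Variant ind_spec p e k : bool -> Type :=
  | IndIn of p <= k & k < p + e : ind_spec p e k true
  | IndOut of (k < p) || (p + e <= k) : ind_spec p e k false.

Lemma indP p e k : ind_spec p e k (ind p e k).
Proof.
rewrite /ind; case: (leqP p k) => h1; case: (ltnP k (p + e)) => h2;
  by constructor; rewrite // ?h1 ?h2 ?orbT.
Qed.

(* For goals [e1 -> ... -> em -> C] with boolean equations [ei] between [ind]s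
   and [C] linear, on which [lia] alone blows up. *)
Ltac ind_lia :=
  repeat (
    lazymatch goal with
    | |- (true = false) -> _ => discriminate
    | |- (false = true) -> _ => discriminate
    | |- (?x = ?x) -> _ => move=> _
    | |- (?b = ?c) -> _ =>
      first [ match constr:((b, c)) with context [ind ?p ?e ?k] =>
                case: (indP p e k) => [? ?|?]; try (exfalso; lia)
              end
            | progress simpl ]
    end); try lia.

Ltac len12 e := have [?|?] : e = 1 \/ e = 2 by lia.

(** The text is a total sequence rather than a word, so that words can be given by Boolean formulas
    and cut to length by [mkseq] afterwards. *)
Definition occurs (f : word) (X : nat -> bool) (p : nat) : Prop :=
  forall k, k < size f -> X (p + k) = nth false f k.

Lemma infix_occurs (f w : word) :
  infix f w <-> exists2 p, p + size f <= size w & occurs f (nth false w) p.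
Proof.
split.
  case/infixP=> s1 [s2 ->]; exists (size s1); first by rewrite !size_cat leq_add2l leq_addr.
  by move=> k hk; rewrite nth_cat ltnNge leq_addr addKn nth_cat hk.
case=> p hp H; apply/infixP; exists (take p w), (drop (p + size f) w).
rewrite -[LHS](cat_take_drop p); congr (_ ++ _).
rewrite -[LHS](cat_take_drop (size f)) drop_drop addnC; congr (_ ++ _).
apply: (@eq_from_nth _ false); first by (rewrite size_takel ?size_drop; lia).
move=> k; rewrite size_takel ?size_drop; last by lia.
by move=> hk; rewrite nth_take // nth_drop H.
Qed.

Lemma occursE f X Y p : X =1 Y -> occurs f X p -> occurs f Y p.
Proof. by move=> e H k /H; rewrite e. Qed.

Definition op_len (o : op) : nat := if is_swap o then 2 else 1.
Definition mkop (p e : nat) : op := if e == 1 then Rep p else Swp p.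

Lemma op_len_bound o : 0 < op_len o <= 2. Proof. by case: o. Qed.

Lemma mem_modified o k : (k \in modified o) = ind (op_pos o) (op_len o) k.
Proof. by case: o => i /=; rewrite !inE /ind /op_len /=; lia. Qed.

Lemma apply_op_flip w o w' : apply_op w o = Some w' ->
  [/\ size w' = size w, op_pos o + op_len o <= size w,
      forall k, nth false w' k = nth false w k (+) ind (op_pos o) (op_len o) k
    & is_swap o -> nth false w (op_pos o) != nth false w (op_pos o).+1].
Proof.
case: o => i /=; case: ifP => // hi [<-]; rewrite /op_len /=; split=> //.
- by rewrite size_set_nth; lia.
- by lia.
- move=> k; rewrite nth_set_nth /= /ind.
  case: eqP => [->|hk]; first by rewrite leqnn addn1 ltnSn addbT.
  by rewrite (_ : _ && _ = false) ?addbF //; lia.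
- by rewrite !size_set_nth; lia.
- by lia.
- move=> k; rewrite nth_set_nth /= nth_set_nth /= /ind.
  case/andP: hi => _ hi.
  case: eqP => [->|hk].
    have -> : i <= i.+1 < i + 2 by lia.
    by move: hi; do 2 case: nth.
  case: eqP => [->|hk2].
    have -> : i <= i < i + 2 by lia.
    by move: hi; do 2 case: nth.
  by rewrite (_ : _ && _ = false) ?addbF //; lia.
- by case/andP: hi.
Qed.

Lemma apply_mkop w p e : 0 < e <= 2 -> p + e <= size w ->
  (e = 2 -> nth false w p != nth false w p.+1) ->
  exists2 w', apply_op w (mkop p e) = Some w' &
    size w' = size w /\ forall k, nth false w' k = nth false w k (+) ind p e k.
Proof.
move=> he hp hs.
have [w' E] : exists w', apply_op w (mkop p e) = Some w'.
  len12 e; subst e; rewrite /mkop /=.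
    by rewrite (_ : p < size w); [eexists|lia].
  by rewrite (_ : p.+1 < size w) ?hs //; [eexists|lia].
exists w' => //; have [-> _ Hn _] := apply_op_flip E; split=> // k.
by rewrite Hn; len12 e; subst e.
Qed.

Lemma ffree_occurs f w p :
  ffree f w -> p + size f <= size w -> occurs f (nth false w) p -> False.
Proof. by move=> /negP h hp H; apply: h; apply/infix_occurs; exists p. Qed.

(** * Pairs of words that differ in two blocks *)

Lemma uniq_modified2 a b : uniq (flatten (map modified [:: a; b])) ->
  op_pos a + op_len a <= op_pos b \/ op_pos b + op_len b <= op_pos a.
Proof.
by rewrite /= cats0 cat_uniq => /and3P[_ /hasPn H _]; move: H;
  case: a => i; case: b => j; rewrite /= /op_len /=;
  [ move/(_ j) | move=> /[dup] /(_ j) + /(_ j.+1) | move/(_ j)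
  | move=> /[dup] /(_ j) + /(_ j.+1)]; rewrite /= !inE; lia.
Qed.

(** If there is a gap, or if two blocks of length two form four consecutive positions, the union
    splits into two disjoint blocks in only one way. Three consecutive positions split both as 2 + 1
    and as 1 + 2; the last alternative records the second splitting. *)
Lemma two_blocks p1 e1 p2 e2 a ea b eb :
  0 < e1 <= 2 -> 0 < e2 <= 2 -> 0 < ea <= 2 -> 0 < eb <= 2 ->
  p1 + e1 <= p2 \/ p2 + e2 <= p1 -> a + ea <= b ->
  [\/ a + ea < b, ea = 2 /\ eb = 2 | ea = 2 /\ eb = 1] ->
  (forall k, ind p1 e1 k (+) ind p2 e2 k = ind a ea k (+) ind b eb k) ->
  [\/ p1 = a /\ e1 = ea, p1 = b /\ e1 = eb
    | [/\ ea = 2, eb = 1, b = a + 2 &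
       (p1 = a /\ e1 = 1) /\ (p2 = a.+1 /\ e2 = 2) \/ p1 = a.+1 /\ e1 = 2]].
Proof.
move=> h1 h2 h3 h4 h5 h6 h7 H.
suff : (p1 = a /\ e1 = ea) \/ (p1 = b /\ e1 = eb) \/ (ea = 2 /\ eb = 1 /\ b = a + 2 /\
   ((p1 = a /\ e1 = 1) /\ (p2 = a.+1 /\ e2 = 2) \/ p1 = a.+1 /\ e1 = 2)).
  by case=> [?|[?|[? [? [? ?]]]]]; [constructor 1|constructor 2|constructor 3].
have {}h7 : (a + ea < b \/ ea = 2 /\ eb = 2) \/ ea = 2 /\ eb = 1.
  by case: h7; [left; left|left; right|right].
by len12 e1; len12 e2; len12 ea; len12 eb; subst e1 e2 ea eb;
  move: (H a) (H b) (H a.+1) (H b.+1) (H p1) (H p2) (H p1.+1) (H p2.+1);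
  clear H; ind_lia.
Qed.

(** Flipping the two blocks takes two operations, so a minimal transformation has at most two, and
    its first operation flips one of the blocks, which creates an occurrence of [f]. If the blocks
    form three consecutive positions, the other splitting would swap positions [a.+1] and [a.+2],
    where [u] has equal letters. *)
Lemma two_block_obstruction f u v a ea b eb pa pb :
  size f < size u -> size v = size u ->
  0 < ea <= 2 -> 0 < eb <= 2 -> a + ea <= b -> b + eb <= size u ->
  (forall k, nth false v k = nth false u k (+) ind a ea k (+) ind b eb k) ->
  (ea = 2 -> nth false u a != nth false u a.+1) ->
  (eb = 2 -> nth false u b != nth false u b.+1) ->
  [\/ a + ea < b, ea = 2 /\ eb = 2
    | [/\ ea = 2, eb = 1 & nth false u a.+1 = nth false u a.+2]] ->
  ffree f u -> ffree f v ->
  pa + size f <= size u -> occurs f (fun k => nth false u k (+) ind a ea k) pa ->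
  pb + size f <= size u -> occurs f (fun k => nth false u k (+) ind b eb k) pb ->
  ~ tilde_isometric f.
Proof.
move=> hm hv hea heb hab hb Hv sa sb sep fu fv hpa Hpa hpb Hpb iso.
have [ops [[T [_ min] uq] fr]] := iso _ hm u v erefl hv fu fv.
have {}min : size ops <= 2.
  have [u1 E1 [z1 n1]] : exists2 u1, apply_op u (mkop a ea) = Some u1 &
      size u1 = size u /\ forall k, nth false u1 k = nth false u k (+) ind a ea k.
    by apply: apply_mkop => //; lia.
  have [u2 E2 [z2 n2]] : exists2 u2, apply_op u1 (mkop b eb) = Some u2 &
      size u2 = size u1 /\ forall k, nth false u2 k = nth false u1 k (+) ind b eb k.
    apply: apply_mkop => //; first by lia.
    have -> : nth false u1 b = nth false u b.
      by rewrite n1; case: indP; rewrite ?addbF //; lia.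
    have -> : nth false u1 b.+1 = nth false u b.+1.
      by rewrite n1; case: indP; rewrite ?addbF //; lia.
    by [].
  apply: (min [:: mkop a ea; mkop b eb]).
  rewrite /tilde_trans /= E1 E2; congr Some.
  by apply: (@eq_from_nth _ false) => [|k _]; rewrite ?hv ?z2 // n2 n1 Hv.
have bad w p : p + size f <= size w -> occurs f (nth false w) p ->
    ffree f w -> False by move=> h1 h2 h3; apply: (ffree_occurs h3 h1).
case: ops T uq fr min => [|o1 [|o2 [|//]]] T uq fr _.
- case: T => E; move: (Hv a); rewrite -E; case: nth.
    by case: (indP a) => [_ _|]; [case: indP => // ? ?; lia|lia].
  by case: (indP a) => [_ _|]; [case: indP => // ? ?; lia|lia].
(* The two blocks span at least three positions, too many for one operation. *)
- move: T; rewrite /tilde_trans /=; case E: apply_op => [w|//] [Ew].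
  have [_ _ Hw _] := apply_op_flip E.
  have {}Hw k : ind (op_pos o1) (op_len o1) k = ind a ea k (+) ind b eb k.
    by apply: (@addbI (nth false u k)); rewrite -Hw Ew Hv addbA.
  have sep' : (a + ea < b \/ ea = 2).
    by case: sep; [left|right; lia|case; right].
  have h := op_len_bound o1.
  move: (Hw a) (Hw (b + eb).-1); clear -hea heb hab sep' h.
  by move: (op_len o1) h (op_pos o1) => e h p; ind_lia.
move: T; rewrite /tilde_trans /=; case E1: apply_op => [w|//].
case E2: apply_op => [w2|//] [Ew].
have [zw _ Hw sw] := apply_op_flip E1.
have [_ _ Hw2 sw2] := apply_op_flip E2.
have {Ew Hw2}Hk k : ind (op_pos o1) (op_len o1) k (+) ind (op_pos o2) (op_len o2) k
     = ind a ea k (+) ind b eb k.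
  by apply: (@addbI (nth false u k)); rewrite !addbA -Hw -Hw2 Ew Hv.
have sep' : [\/ a + ea < b, ea = 2 /\ eb = 2 | ea = 2 /\ eb = 1].
  by case: sep => [?|?|[? ? _]]; [constructor 1|constructor 2|constructor 3].
have fw : ffree f w.
  by move: fr; rewrite /= E1 => /andP[_]; case: apply_op => [?|] /= /andP[].
case: (two_blocks (op_len_bound o1) (op_len_bound o2) hea heb (uniq_modified2 uq)
  hab sep' Hk).
- case=> e1 e2; apply: (bad w pa) => //; first by rewrite zw.
  by apply: occursE Hpa => k; rewrite Hw e1 e2.
- case=> e1 e2; apply: (bad w pb) => //; first by rewrite zw.
  by apply: occursE Hpb => k; rewrite Hw e1 e2.
case=> x1 x2 x3 x4.
have {x1 x2 x3 sep} eqU : nth false u a.+1 = nth false u a.+2.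
  by case: sep => [|[_]|[]//]; clear -x1 x2 x3; [lia|rewrite x2].
case: x4 => [[[p1 l1] [p2 l2]]|[p1 l1]].
  have : is_swap o2 by move: l2; rewrite /op_len; case: is_swap.
  move/sw2; rewrite p2 !Hw p1 l1 eqU.
  by clear; (case: indP; first (by lia)); (case: indP; first (by lia)); rewrite eqxx.
have : is_swap o1 by move: l1; rewrite /op_len; case: is_swap.
by move/sw; rewrite p1 eqU eqxx.
Qed.

(** * Overlaps with two errors: a third occurrence between two near-occurrences *)

(** The last relation compares two ways from [k] to [k + r]: through [k + p] by the first two
    relations, and directly by reading [X (r + k)] in both near-occurrences. The letters of [f]
    cancel, leaving a condition on the defects alone. *)
Lemma occurs_shift f X r D0 Dr p :
  (forall k, k < size f -> X k = nth false f k (+) D0 k) ->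
  (forall k, k < size f -> X (r + k) = nth false f k (+) Dr k) ->
  p <= r -> occurs f X p ->
  [/\ forall k, k + p < size f -> nth false f (k + p) = nth false f k (+) D0 (k + p),
      forall k, k + (r - p) < size f ->
        nth false f (k + (r - p)) = nth false f k (+) Dr k
    & forall k, k + r < size f -> D0 (k + p) (+) Dr (k + p) = D0 (k + r) (+) Dr k].
Proof.
move=> H0 Hr hp H.
have A k : k + p < size f -> nth false f (k + p) = nth false f k (+) D0 (k + p).
  by move=> hk; rewrite -(H k) ?[p + k]addnC ?H0 ?addbK //; apply: leq_ltn_trans hk; rewrite leq_addr.
have B k : k + (r - p) < size f -> nth false f (k + (r - p)) = nth false f k (+) Dr k.
  by move=> hk; rewrite -Hr -?H //; [congr X; lia | lia].
split=> // k hk.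
have [h1 h2 h3] : [/\ k + p < size f, k < size f & k + p + (r - p) < size f].
  by split; lia.
have e2 := B _ h3; have e3 := H0 _ hk; have e4 := Hr _ h2; move: (A _ h1) e2 e3 e4.
have -> : k + p + (r - p) = k + r by clear -hp; lia.
rewrite [r + k]addnC => -> -> ->.
by rewrite -!addbA => /addbI <-; rewrite addbCA [D0 (k + r) (+) _]addbC addbK.
Qed.

Lemma ind_gt p e k : p + e <= k -> ind p e k = false.
Proof. by case: indP => //; lia. Qed.

Lemma ind_lt p e k : k < p -> ind p e k = false.
Proof. by case: indP => //; lia. Qed.

Lemma ind_shift r p e k : ind (r + p) e (r + k) = ind p e k.
Proof. by rewrite /ind -addnA leq_add2l ltn_add2l. Qed.

Lemma nth_mkseq_flip U V m a ea b eb : a + ea <= m -> b + eb <= m ->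
  (forall k, V k = U k (+) ind a ea k (+) ind b eb k) ->
  forall k, nth false (mkseq V m) k =
            nth false (mkseq U m) k (+) ind a ea k (+) ind b eb k.
Proof.
move=> ha hb HV k; case: (ltnP k m) => hk; first by rewrite !nth_mkseq.
by rewrite !nth_default ?size_mkseq // !ind_gt //; lia.
Qed.

Lemma ffree_mkseq f U m :
  (forall p, p + size f <= m -> occurs f U p -> False) -> ffree f (mkseq U m).
Proof.
move=> H; apply/negP => /infix_occurs[p]; rewrite size_mkseq => hp Hp.
by apply: (H p hp) => k hk; rewrite -Hp // nth_mkseq //; lia.
Qed.

Lemma occurs_mkseq_flip f U m p a e : p + size f <= m ->
  occurs f (fun k => U k (+) ind a e k) p ->
  occurs f (fun k => nth false (mkseq U m) k (+) ind a e k) p.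
Proof. by move=> hp H k hk; rewrite nth_mkseq ?H //; lia. Qed.

(** This excludes occurrences in [u]. The last position of the block at [i] lies before [j], so only
    the copy of this block moved left by [p] can cover it, which forces [p = 0]. Then nothing covers
    [j], because [r > 0]. *)
Lemma overlap_left_flip_free i ei j ej r p l : 0 < r -> p <= r ->
  0 < ei <= 2 -> 0 < ej <= 2 -> i + ei <= j -> j < l ->
  (forall k, k < l -> ind (r + j) ej (k + p) (+) ind i ei (k + p) =
                      ind (r + j) ej (k + r) (+) ind i ei k) -> False.
Proof.
move=> hr hp hei hej hij hl H.
have li : i < l by lia.
have li1 : i.+1 < l by lia.
by len12 ei; len12 ej; subst ei ej;
  move: (H _ li) (H _ li1) (H _ hl); clear H; ind_lia.
Qed.

(** This locates occurrences in [v]. As functions of [k], the blocks start at [r + i - p] and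
    [j - p] on the left, at [j] and [i] on the right. Matching them in this order gives [p = j - i]
    and [r = 2p], with equal types. A swap followed at once by a replacement covers three
    consecutive positions, and its other splitting gives [p = 2], [r = 3]. *)
Lemma overlap_right_flip_free i ei j ej r p l : 0 < r -> p <= r ->
  0 < ei <= 2 -> 0 < ej <= 2 -> i + ei <= j -> j + ej <= l ->
  (forall k, k < l -> ind (r + i) ei (k + p) (+) ind j ej (k + p) =
                      ind (r + i) ei (k + r) (+) ind j ej k) ->
  (i + ei < j \/ ei = 2 /\ ej = 2 ->
     ei = ej /\ p = j - i /\ r = (j - i) + (j - i)) /\
  (ei = 2 -> ej = 1 -> j = i + 2 -> p = 2 /\ r = 3).
Proof.
move=> hr hp hei hej hij hl H.
have li : i < l by lia.
have li1 : i.+1 < l by lia.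
have lj : j < l by lia.
len12 ei; len12 ej; subst ei ej.
all: try (have lj1 : j.+1 < l by lia); try move: (H _ lj1).
all: move: (H _ li) (H _ li1) (H _ lj); clear H; ind_lia.
Qed.

Lemma overlap_two_errors f i ei j ej r (F := nth false f) :
  0 < r -> 0 < ei <= 2 -> 0 < ej <= 2 -> i + ei <= j -> j + ej + r <= size f ->
  (forall k, k + r < size f -> F (k + r) = F k (+) ind i ei k (+) ind j ej k) ->
  (ei = 2 -> F i != F i.+1) -> (ej = 2 -> F j != F j.+1) ->
  [\/ i + ei < j, ei = 2 /\ ej = 2 | [/\ ei = 2, ej = 1 & F i.+1 != F i.+2]] ->
  tilde_isometric f ->
  [/\ ei = ej, r = (j - i) + (j - i) &
      forall k, k + (j - i) < size f -> F (k + (j - i)) = F k (+) ind j ej k].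
Proof.
move=> hr hei hej hij hj H si sj sep iso.
pose W k := if k < r then F k else F (k - r).
have Wr k : W (r + k) = F k by rewrite /W ltnNge leq_addr addKn.
have W0 k : k < size f -> W k = F k (+) ind (r + i) ei k (+) ind (r + j) ej k.
  rewrite /W; case: (ltnP k r) => hk hn; first by rewrite !ind_lt ?addbF //; lia.
  have {hk hn}[k' -> hk] : exists2 k', k = r + k' & k' + r < size f.
    by exists (k - r); lia.
  by rewrite addKn [r + k']addnC H // [k' + r]addnC !ind_shift -!addbA
    [ind j ej _ (+) _]addbCA addbb addbF addbb addbF.
pose U k := W k (+) ind (r + i) ei k.
pose V k := W k (+) ind (r + j) ej k.
have Hl k : k < size f - r -> k + r < size f by clear; lia.
have U0 k : k < size f -> U k = F k (+) ind (r + j) ej k.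
  by move=> hk; rewrite /U W0 // addbAC addbK.
have Ur k : k < size f -> U (r + k) = F k (+) ind i ei k.
  by move=> hk; rewrite /U Wr ind_shift.
have V0 k : k < size f -> V k = F k (+) ind (r + i) ei k.
  by move=> hk; rewrite /V W0 // addbK.
have Vr k : k < size f -> V (r + k) = F k (+) ind j ej k.
  by move=> hk; rewrite /V Wr ind_shift.
have jl : j + ej <= size f - r by clear -hj hej; lia.
have fu : ffree f (mkseq U (r + size f)).
  apply: ffree_mkseq => p hp Hp; have {}hp : p <= r by clear -hp; lia.
  have [_ _ C] := occurs_shift U0 Ur hp Hp.
  apply: (@overlap_left_flip_free i ei j ej r p (size f - r)) => //.
    by clear -hej jl; lia.
  by move=> k /Hl /C.
have [fv|nfv] := boolP (ffree f (mkseq V (r + size f))).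
  exfalso; move: iso.
  apply: (@two_block_obstruction f (mkseq U (r + size f)) (mkseq V (r + size f))
      (r + i) ei (r + j) ej r 0); rewrite ?size_mkseq //.
  - by clear -hr; lia.
  - by clear -hij; lia.
  - by clear -hj; lia.
  - apply: nth_mkseq_flip => [||k]; [by clear -hij hj; lia|by clear -hj; lia|].
    by rewrite /U /V addbK.
  - move=> e; rewrite !nth_mkseq; [|clear -hij hj e; lia..].
    rewrite -addnS /U !Wr !ind_shift.
    by move: (si e); do 2 (case: indP; [|clear -e; lia]); do 2 case: (F _).
  - move=> e; rewrite !nth_mkseq; [|clear -hij hj e; lia..].
    rewrite -addnS /U !Wr !ind_shift.
    by move: (sj e); do 2 (case: indP; [clear -hij; lia|]); do 2 case: (F _).
  - case: sep => [?|?|[e1 e2 e3]]; [by constructor 1; lia|by constructor 2|].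
    have [lij|eij] := ltnP (i + ei) j; first by constructor 1; lia.
    (* Flipping the block at [i] changes position [i.+1] but not [i.+2], so different letters of [f]
       there become equal letters of [u]. *)
    constructor 3; split => //; rewrite !nth_mkseq; [|clear -hij hj e1 e2; lia..].
    rewrite -!addnS /U !Wr !ind_shift; move: e3.
    case: indP; [|clear -e1; lia]; case: indP; [clear -e1; lia|].
    by do 2 case: (F _).
  - apply: occurs_mkseq_flip => // k hk.
    by rewrite /U addbK Wr.
  - by clear; lia.
  - apply: occurs_mkseq_flip => [|k hk]; first by clear; lia.
    by rewrite add0n U0 // addbK.
move: nfv; rewrite /ffree negbK => /infix_occurs[p]; rewrite size_mkseq => hp Hp.
have {}hp : p <= r by clear -hp; lia.
have {}Hp : occurs f V p.
  by move=> k hk; rewrite -Hp // nth_mkseq //; clear -hp hk; lia.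
have [A B C] := occurs_shift V0 Vr hp Hp.
have [c1 c2] := @overlap_right_flip_free i ei j ej r p (size f - r) hr hp hei hej hij jl
   (fun k hk => C k (Hl k hk)).
(* The occurrence at [p = j - i] makes [f] periodic with period [p], up to the block at
   [r + i - p = j]. *)
have {}c1 : i + ei < j \/ ei = 2 /\ ej = 2 ->
  [/\ ei = ej, r = (j - i) + (j - i) &
      forall k, k + (j - i) < size f -> F (k + (j - i)) = F k (+) ind j ej k].
  move=> /c1[e1 [e2 e3]]; split=> // k; rewrite -e2 => hk; rewrite [LHS]A //.
  by congr addb; rewrite e1 /ind; clear -e2 e3 hij; lia.
case: sep => [h|h|[h1 h2 _]]; [by apply: c1; left|by apply: c1; right|].
have [lij|eij] := ltnP (i + ei) j; first by apply: c1; left.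
(* Now [r - p = 1], and the second relation of [occurs_shift] at [i] makes the two letters of the
   swap at [i] equal. *)
have [e1 e2] : p = 2 /\ r = 3 by apply: c2 => //; clear -h1 hij eij; lia.
have Fi : F i.+1 = F i.
  have := B i; rewrite e1 e2 addn1 ind_lt ?addbF; last by clear -hij h1; lia.
  by apply; clear -hj hij h1 h2 e2; lia.
by move: (si h1); rewrite Fi eqxx.
Qed.

(** * Pairs of words that differ in three equally spaced blocks *)

Lemma run_flip u v ops : run u ops = Some v ->
  uniq (flatten (map modified ops)) ->
  forall k, nth false v k = nth false u k (+) (k \in flatten (map modified ops)).
Proof.
elim: ops u => [|o os IH] u /= ; first by case=> -> _ k; rewrite addbF.
case E: apply_op => [w|//] R; rewrite cat_uniq => /and3P[_ /hasPn dis uq] k.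
rewrite (IH w R uq) mem_cat mem_modified.
have [_ _ -> _] := apply_op_flip E; rewrite -addbA; congr addb.
case: (boolP (k \in flatten _)) => [/dis|_]; last by rewrite addbF orbF.
by move/negbTE=> e; move: (mem_modified o k); rewrite [LHS]e => <-.
Qed.

(** For [e = 1] the three positions are isolated, so a swap does not fit. For [e = 2], at most three
    operations cover six positions, so all are swaps; even when the blocks are contiguous, three
    pairs tile them in only one way. *)
Lemma first_op_three_blocks i e s o1 os : 0 < e <= 2 -> 1 < s -> i + e <= s ->
  size os <= 2 ->
  uniq (flatten (map modified (o1 :: os))) ->
  (forall k, (k \in flatten (map modified (o1 :: os))) =
     ind (i + 2 * s) e k (+) ind (i + 3 * s) e k (+) ind (i + 4 * s) e k) ->
  op_len o1 = e /\
  [\/ op_pos o1 = i + 2 * s, op_pos o1 = i + 3 * s | op_pos o1 = i + 4 * s].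
Proof.
move=> he hs his hos uq H.
suff : op_len o1 = e /\
  (op_pos o1 = i + 2 * s \/ op_pos o1 = i + 3 * s \/ op_pos o1 = i + 4 * s).
  by case=> ? [?|[?|?]]; split=> //; [constructor 1|constructor 2|constructor 3].
have M k : ind (op_pos o1) (op_len o1) k ->
    ind (i + 2 * s) e k (+) ind (i + 3 * s) e k (+) ind (i + 4 * s) e k = true.
  by move=> h; rewrite -H /= mem_cat mem_modified h.
have h1 := op_len_bound o1.
have M0 : ind (op_pos o1) (op_len o1) (op_pos o1).
  by clear -h1; case: indP => //; lia.
have M1 : op_len o1 = 2 -> ind (op_pos o1) (op_len o1) (op_pos o1).+1.
  by clear; case: indP => //; lia.
len12 e; subst e.
  have [a|a] : op_len o1 = 1 \/ op_len o1 = 2 by clear -h1; lia.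
    move: a (M _ M0); clear -hs his; move: (op_pos o1) (op_len o1) => p e ?; subst e.
    by ind_lia.
  move: a (M _ M0) (M _ (M1 a)); clear -hs his; move: (op_pos o1) (op_len o1) => p e ?; subst e.
  by ind_lia.
have D : 6 <= size (flatten (map modified (o1 :: os))).
  pose D := [:: i + 2 * s; (i + 2 * s).+1; i + 3 * s; (i + 3 * s).+1;
                i + 4 * s; (i + 4 * s).+1].
  apply: (@uniq_leq_size _ D).
    by rewrite /= !inE; clear -hs his; lia.
  move=> k; rewrite H /D !inE => hk.
  by clear -hk hs his; do 3 (case: indP); lia.
have szm o : size (modified o) = op_len o by case: o.
case: os hos uq D H {M M0 M1} => [|a [|b []]] // _ uq D H.
- by move: D; rewrite /= cats0 szm; clear -h1; lia.
- move: D (op_len_bound a); rewrite /= cats0 size_cat !szm; clear -h1; lia.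
have [L1 La Lb] : [/\ op_len o1 = 2, op_len a = 2 & op_len b = 2].
  move: D (op_len_bound a) (op_len_bound b); rewrite /= cats0 !size_cat !szm.
  by clear -h1 => *; split; lia.
split=> //.
have d1 : op_pos o1 + 2 <= op_pos a \/ op_pos a + 2 <= op_pos o1.
  rewrite -{1}L1 -La; apply: uniq_modified2; move: uq.
  by rewrite /= !cats0 catA cat_uniq => /andP[].
have d2 : op_pos o1 + 2 <= op_pos b \/ op_pos b + 2 <= op_pos o1.
  rewrite -{1}L1 -Lb; apply: uniq_modified2; move: uq.
  by rewrite /= !cats0 uniq_catCA cat_uniq => /and3P[].
have {}H k : ind (op_pos o1) 2 k || (ind (op_pos a) 2 k || ind (op_pos b) 2 k) =
    ind (i + 2 * s) 2 k (+) ind (i + 3 * s) 2 k (+) ind (i + 4 * s) 2 k.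
  by rewrite -H /= cats0 !mem_cat !mem_modified L1 La Lb.
move: H d1 d2; clear -hs his.
move: (op_pos o1) (op_pos a) (op_pos b) => p1 p2 p3 H d1 d2.
have l2 : i + 2 * s <= p2 by clear d1 d2; move: (H p2); clear H; ind_lia.
have l3 : i + 2 * s <= p3 by clear d1 d2; move: (H p3); clear H; ind_lia.
have u2 : p2 <= i + 4 * s by clear d1 d2; move: (H p2.+1); clear H; ind_lia.
have u3 : p3 <= i + 4 * s by clear d1 d2; move: (H p3.+1); clear H; ind_lia.
move: (H p1) (H p1.+1) (H (i + 2 * s)) (H (i + 4 * s).+1); clear H.
by ind_lia.
Qed.

(** Below [l <= i + s] the right-hand side is just the block at [i], and it must be covered by the
    block at [i + 3 * s - p] or the one at [i + s - p]. The letters of [f] exclude both solutions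
    later. *)
Lemma three_blocks_source_shift i e s l p : 0 < e <= 2 -> 1 < s -> i + e <= s ->
  i + e <= l <= i + s -> p <= 3 * s ->
  (forall k, k < l -> ind (i + 3 * s) e (k + p) (+) ind (i + s) e (k + p) =
     ind (i + 3 * s) e (k + 3 * s) (+) ind (i + s) e k) -> p = s \/ p = 3 * s.
Proof.
move=> he hs his hl hp H.
have li : i < l by clear -he hl; lia.
len12 e; subst e; [|have li1 : i.+1 < l by clear -hl; lia].
all: try move: (H _ li1).
all: by move: (H _ li); clear H; ind_lia.
Qed.

Lemma three_blocks_target_shift i e s l p : 0 < e <= 2 -> 1 < s -> i + e <= s ->
  i + e <= l <= i + s -> p <= 3 * s ->
  (forall k, k < l -> ind (i + 2 * s) e (k + p) (+) ind i e (k + p) =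
     ind (i + 2 * s) e (k + 3 * s) (+) ind i e k) -> p = 0 \/ p = 2 * s.
Proof.
move=> he hs his hl hp H.
have li : i < l by clear -he hl; lia.
len12 e; subst e; [|have li1 : i.+1 < l by clear -hl; lia].
all: try move: (H _ li1).
all: by move: (H _ li); clear H; ind_lia.
Qed.

(* Along the residue class of [i] modulo [s], the word [f] reads [aabb]; the
   pair consists of the words reading [aababbb] and [aaababb] there. *)
Lemma three_block_obstruction f i e s (F := nth false f) :
  0 < e <= 2 -> 1 < s -> i + e <= s -> i + e + 3 * s <= size f <= i + 4 * s ->
  (forall k, k + s < size f -> F (k + s) = F k (+) ind (i + s) e k) ->
  (e = 2 -> F i != F i.+1) -> ~ tilde_isometric f.
Proof.
move=> he hs his hn H si iso.
pose G k := F (k %% s).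
have GD q k : G (q * s + k) = G k by rewrite /G modnMDl.
have GS k : G (k + s) = G k by rewrite /G modnDr.
have Gs k : k < s -> G k = F k by move=> hk; rewrite /G modn_small.
have FG k : k < size f ->
    F k = G k (+) ind (i + 2 * s) e k (+) ind (i + 3 * s) e k.
  elim/ltn_ind: k => k IH hk; have [ks|ks] := ltnP k s.
    by rewrite Gs // !ind_lt ?addbF //; clear -ks; lia.
  have [k' ek] : exists k', k = k' + s by exists (k - s); rewrite subnK.
  rewrite ek in hk *; rewrite H // IH ?GS; [|clear -ek hs; lia|clear -hk; lia].
  rewrite -!addbA; congr addb; clear -hs hn hk.
  by do 5 (case: indP => [? ?|?]; try (exfalso; lia)).
pose B q := ind (i + q * s) e.
(* [G] continues the first [s] letters of [f] periodically, which spells [a] throughout the class;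
   the summands [B q] mark the places of [b] in [aababbb] and [aaababb]. *)
pose U k := G k (+) B 2 k (+) B 4 k (+) B 5 k (+) B 6 k.
pose V k := G k (+) B 3 k (+) B 5 k (+) B 6 k.
pose m := 3 * s + size f.
have VU k : V k = U k (+) B 2 k (+) B 3 k (+) B 4 k.
  by rewrite /U /V; case: (G k); do 5 case: (B _ k).
have U0 k : k < size f -> U k = F k (+) ind (i + 3 * s) e k.
  move=> hk; rewrite FG // /U addbK /B [ind (i + 4 * s) _ _]ind_lt;
    [|clear -hn hk; lia].
  rewrite [ind (i + 5 * s) _ _]ind_lt; [|clear -hn hk; lia].
  by rewrite [ind (i + 6 * s) _ _]ind_lt ?addbF; [|clear -hn hk; lia].
have Bs q k : B (3 + q) (3 * s + k) = B q k.
  by rewrite /B mulnDl addnCA ind_shift.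
have B2s k : B 2 (3 * s + k) = false by rewrite /B ind_gt; [|clear -his; lia].
have Ur k : k < size f -> U (3 * s + k) = F k (+) ind (i + s) e k.
  move=> hk; rewrite FG // /U GD B2s (Bs 1) (Bs 2) (Bs 3) /B mul1n.
  by case: (G k); do 3 case: ind.
have V0 k : k < size f -> V k = F k (+) ind (i + 2 * s) e k.
  move=> hk; rewrite FG // /V /B [ind (i + 5 * s) _ _]ind_lt; [|clear -hn hk; lia].
  rewrite [ind (i + 6 * s) _ _]ind_lt ?addbF; [|clear -hn hk; lia].
  by case: (G k); do 2 case: ind.
have Vr k : k < size f -> V (3 * s + k) = F k (+) ind i e k.
  move=> hk; rewrite FG // /V GD (Bs 0) (Bs 2) (Bs 3) /B mul0n addn0.
  by case: (G k); do 3 case: ind.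
have Hl k : k < size f - 3 * s -> k + 3 * s < size f by clear; lia.
have hl : i + e <= size f - 3 * s <= i + s by clear -hn; lia.
(* The letters [a], [a], [b] at [i], [i + s], [i + 2 * s] contradict the shifts that survive the
   compatibility test. *)
have Fi2 : F (i + s + s) = ~~ F (i + s).
  rewrite H; last by clear -hn he; lia.
  by case: indP; rewrite ?addbT //; clear -he; lia.
have Fi1 : F (i + s) = F i.
  rewrite H; last by clear -hn he; lia.
  by case: indP; rewrite ?addbF //; clear -he hs; lia.
have fu : ffree f (mkseq U m).
  apply: ffree_mkseq => p hp Hp; have {}hp : p <= 3 * s by clear -hp; lia.
  have [A A' C] := occurs_shift U0 Ur hp Hp.
  case: (three_blocks_source_shift he hs his hl hp (fun k hk => C k (Hl k hk))) => ep.
    have := A (i + s); rewrite ep -/F Fi2 => /(_ ltac:(clear -hn he; lia)).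
    by case: indP => [|_]; [clear -he hs; lia|case: (F _)].
  have := A' (i + s); rewrite ep subnn addn0 -/F => /(_ ltac:(clear -hn he hs; lia)).
  by case: indP => [_ _|]; [case: (F _)|clear -he; lia].
have fv : ffree f (mkseq V m).
  apply: ffree_mkseq => p hp Hp; have {}hp : p <= 3 * s by clear -hp; lia.
  have [A A' C] := occurs_shift V0 Vr hp Hp.
  case: (three_blocks_target_shift he hs his hl hp (fun k hk => C k (Hl k hk))) => ep.
    have := A (i + 2 * s); rewrite ep addn0 -/F => /(_ ltac:(clear -hn he hs; lia)).
    by case: indP => [_ _|]; [case: (F _)|clear -he; lia].
  have := A' i; rewrite ep (_ : 3 * s - 2 * s = s); last by clear; lia.
  rewrite -/F Fi1 => /(_ ltac:(clear -hn he hs; lia)).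
  by case: indP => [_ _|]; [case: (F _)|clear -he; lia].
have nuv k : nth false (mkseq V m) k =
    nth false (mkseq U m) k (+) B 2 k (+) B 3 k (+) B 4 k.
  case: (ltnP k m) => hk; first by rewrite !nth_mkseq.
  by rewrite !nth_default ?size_mkseq // /B !ind_gt //; clear -hk hn his; lia.
have BG q q' : e = 2 -> B q (i + q' * s) = (q == q') /\ B q (i + q' * s).+1 = (q == q').
  move=> e2; rewrite /B e2.
  have [->|] := eqVneq q q'.
    by split; case: indP => //; clear; lia.
  rewrite neq_ltn => /orP[lq|lq];
    [have lm : q.+1 * s <= q' * s by rewrite leq_mul2r lq orbT
    |have lm : q'.+1 * s <= q * s by rewrite leq_mul2r lq orbT];
    by split; case: indP => //; move: lm; rewrite mulSn; clear -his e2; lia.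
(* Both positions of a block are flipped together, so its two letters remain different and the swap
   is defined. *)
have sU q : e = 2 -> q <= 4 ->
    nth false (mkseq U m) (i + q * s) != nth false (mkseq U m) (i + q * s).+1.
  move=> e2 hq; have hqs : q * s <= 4 * s by rewrite leq_mul2r hq orbT.
  have h1 : (i + q * s).+1 < m by move: hqs; rewrite /m; clear -hn e2; lia.
  rewrite !nth_mkseq //; last by apply: ltnW.
  rewrite /U !(proj1 (BG _ _ e2)) !(proj2 (BG _ _ e2)).
  rewrite -addSn ![_ + q * s]addnC !GD !Gs; [|clear -his e2; lia..].
  by move: (si e2); do 2 case: (F _); do 4 case: (_ == q).
have [ops [[T [_ min] uq] fr]] := iso m ltac:(clear -hs; rewrite /m; lia)
  (mkseq U m) (mkseq V m) (size_mkseq _ _) (size_mkseq _ _) fu fv.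
have {}min : size ops <= 3.
  have sz q : q <= 4 -> i + q * s + e <= m.
    move=> hq; have hqs : q * s <= 4 * s by rewrite leq_mul2r hq orbT.
    by move: hqs; rewrite /m; clear -hn; lia.
  have [u1 E1 [z1 n1]] : exists2 u1, apply_op (mkseq U m) (mkop (i + 2 * s) e) = Some u1 &
      size u1 = m /\ forall k, nth false u1 k = nth false (mkseq U m) k (+) B 2 k.
    rewrite -{2}(size_mkseq U m); apply: apply_mkop => //; first by rewrite size_mkseq sz.
    by move/sU; apply.
  have [u2 E2 [z2 n2]] : exists2 u2, apply_op u1 (mkop (i + 3 * s) e) = Some u2 &
      size u2 = m /\ forall k, nth false u2 k = nth false u1 k (+) B 3 k.
    rewrite -z1; apply: apply_mkop => //; first by rewrite z1 sz.
    move=> e2; rewrite !n1 !(proj1 (BG _ _ e2)) !(proj2 (BG _ _ e2)) !addbF.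
    exact: sU.
  have [u3 E3 [z3 n3]] : exists2 u3, apply_op u2 (mkop (i + 4 * s) e) = Some u3 &
      size u3 = m /\ forall k, nth false u3 k = nth false u2 k (+) B 4 k.
    rewrite -z2; apply: apply_mkop => //; first by rewrite z2 sz.
    move=> e2; rewrite !n2 !n1 !(proj1 (BG _ _ e2)) !(proj2 (BG _ _ e2)).
    by rewrite !addbF; apply: sU.
  apply: (min [:: mkop (i + 2 * s) e; mkop (i + 3 * s) e; mkop (i + 4 * s) e]).
  rewrite /tilde_trans /= E1 E2 E3; congr Some.
  apply: (@eq_from_nth _ false) => [|k _]; first by rewrite size_mkseq.
  by rewrite n3 n2 n1 nuv.
have Hmem k : (k \in flatten (map modified ops)) = B 2 k (+) B 3 k (+) B 4 k.
  apply: (@addbI (nth false (mkseq U m) k)).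
  by rewrite -(run_flip T uq) nuv !addbA.
case: ops T uq fr min Hmem => [|o1 os] T uq fr min Hmem.
  have := Hmem (i + 2 * s); rewrite /B; clear -he hs.
  by do 3 (case: indP); rewrite //; lia.
have [oe op] := first_op_three_blocks he hs his min uq Hmem.
move: T fr; rewrite /tilde_trans /=; case E: apply_op => [w|//] _ /andP[_ fr].
have {fr}fw : ffree f w by case: (os) fr => [|o os'] /= /andP[].
have [zw _ nw _] := apply_op_flip E.
rewrite size_mkseq in zw.
have nW k : k < m -> nth false w k = U k (+) ind (op_pos o1) e k.
  by move=> hk; rewrite nw oe nth_mkseq.
have bad p : p <= 3 * s ->
    (forall k, k < size f -> U (p + k) (+) ind (op_pos o1) e (p + k) = F k) -> False.
  move=> hp H0; have hpm : p + size f <= m by rewrite leq_add2r.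
  apply: (@ffree_occurs f w p fw); first by rewrite zw.
  by move=> k hk; rewrite nW ?H0 //; clear -hk hpm; lia.
(* The first operation yields [aaaabbb], [aabbbbb] or [aabaabb], in which [aabb] begins at entry 2,
   0 or 3. *)
case: op => eo; move: bad; rewrite eo.
- move/(_ (2 * s)); apply; first by rewrite leq_mul2r orbT.
  have B2k q k : B (2 + q) (2 * s + k) = B q k.
    by rewrite /B mulnDl addnCA ind_shift.
  move=> k hk; rewrite -/(B 2 _) /U GD (B2k 0) (B2k 2) (B2k 3) (B2k 4) FG //.
  rewrite [B 4 k]ind_lt; last by clear -hn hk; lia.
  by rewrite /B; case: (G k); do 3 case: ind.
- move/(_ 0); apply=> // k hk.
  by rewrite add0n U0 // addbK.
- move/(_ (3 * s)); apply=> // k hk.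
  by rewrite -/(B 4 _) (Bs 1) Ur // /B mul1n addbK.
Qed.

(** * Periodic words with one defect *)

Lemma mul_trichotomy t a s :
  [\/ t < a /\ t * s + s <= a * s, t = a | a < t /\ a * s + s <= t * s].
Proof.
case: (ltngtP t a) => h; [constructor 1|constructor 3|by constructor 2];
  by split=> //; rewrite -mulSnr leq_mul2r h orbT.
Qed.

(** This tells whether going from [k] to [k + q * s] in steps of [s] meets the defect. For [e <= s]
    at most one step does, so a disjunction can stand for the sum modulo 2. *)
Definition hits j e s q k := has (fun t => ind j e (k + t * s)) (iota 0 q).

Lemma hitsP j e s q k :
  reflect (exists2 t, t < q & ind j e (k + t * s)) (hits j e s q k).
Proof.
by apply: (iffP hasP) => [[t]|[t]] h1 h2; exists t => //;
  move: h1; rewrite mem_iota.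
Qed.

Lemma shift_iter (F : nat -> bool) n j e s : e <= s ->
  (forall k, k + s < n -> F (k + s) = F k (+) ind j e k) ->
  forall q k, k + q * s < n -> F (k + q * s) = F k (+) hits j e s q k.
Proof.
move=> hes H; elim=> [|q IH] k hk; first by rewrite mul0n addn0 addbF.
rewrite mulSnr addnA in hk *.
rewrite H // IH; last by clear -hk; lia.
rewrite /hits -[in RHS]addn1 iotaD has_cat /= orbF -addbA; congr addb.
rewrite -!/(hits _ _ _ _ _) add0n; case: hitsP => [[t tq]|_] //.
case: indP => // h1 h2; case: indP => // h3 h4 _.
by case: (mul_trichotomy t q s); clear -hes h1 h2 h3 h4 tq; lia.
Qed.

Lemma shift_before (F : nat -> bool) n j e s : e <= s ->
  (forall k, k + s < n -> F (k + s) = F k (+) ind j e k) ->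
  forall q k, k + q * s < n -> k + q * s < j + s -> F (k + q * s) = F k.
Proof.
move=> hes H q k hk hj; rewrite (shift_iter hes H) //.
case: hitsP => [[t tq]|_]; last by rewrite addbF.
case: indP => // h1 h2 _.
by case: (mul_trichotomy t q s); clear -hj h1 tq; lia.
Qed.

(** The defect is met after [a] steps from the block at [i] and after [a.-1] steps from the block at
    [i + s]. A shift by [q * s] thus has these two blocks as its errors. *)
Lemma hits_inner i a e s q k : 0 < a < q -> i + e <= s -> k < i + 2 * s ->
  hits (i + a * s) e s q k = ind i e k (+) ind (i + s) e k.
Proof.
move=> /andP[a0 aq] hi hk; case: hitsP => [[t tq]|N].
  case: indP => // h1 h2 _.
  have := mul_trichotomy t a s; have := mul_trichotomy t a.-1 s.
  have : a * s = a.-1 * s + s by rewrite -mulSnr prednK.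
  clear -h1 h2 hi hk => e1.
  case=> [?|?|?]; [|subst t|] => -[?|?|?]; try (subst t);
    by do 2 (case: indP => //); lia.
case: (indP i) => [h1 h2|h].
  by exfalso; apply: N; exists a => //; case: indP => //; clear -h1 h2; lia.
case: indP => // h1 h2; exfalso; apply: N; exists a.-1; first by clear -aq; lia.
have : a * s = a.-1 * s + s by rewrite -mulSnr prednK.
by case: indP => //; clear -h1 h2; lia.
Qed.

(** The defect straddles a multiple of [s]. Its second position is reached from [0] in [a.+1] steps
    and from [s] in [a] steps, its first from [s - 1] in [a] steps. The errors are a single position
    and a pair. *)
Lemma hits_wrap a s q k : 0 < a -> a.+1 < q -> 1 < s -> k < 2 * s - 1 ->
  hits (s - 1 + a * s) 2 s q k = ind 0 1 k (+) ind (s - 1) 2 k.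
Proof.
move=> a0 aq hs hk; case: hitsP => [[t tq]|N].
  case: indP => // h1 h2 _.
  have := mul_trichotomy t a s; have := mul_trichotomy t a.+1 s.
  have : a.+1 * s = a * s + s by rewrite -mulSnr.
  clear -h1 h2 hs hk => e1.
  case=> [?|?|?]; [|subst t|] => -[?|?|?]; try (subst t);
    by do 2 (case: indP => //); lia.
case: (indP 0) => [h1 h2|h].
  exfalso; apply: N; exists a.+1 => //.
  by rewrite mulSnr; case: indP => //; clear -h1 h2 hs; lia.
case: indP => // h1 h2; exfalso; apply: N; exists a; first by clear -aq; lia.
by case: indP => //; clear -h1 h2; lia.
Qed.

(** This selects an overlap length [l] in a window of width [s] for which the shift [n - l] is a
    multiple of [s]. *)
Lemma shift_residue n a s : 0 < s -> a <= n ->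
  exists l q, [/\ n = l + q * s, a <= l & l < a + s].
Proof.
move=> hs ha; exists (a + (n - a) %% s), ((n - a) %/ s).
rewrite leq_addr ltn_add2l ltn_mod hs; split=> //.
by rewrite -addnA [_ %% _ + _]addnC -divn_eq subnKC.
Qed.

(** The shift by [q * s] has errors at [i] and [i + s], the second possibly cut to length one by the
    end of the overlap. Then [overlap_two_errors] leaves only [q = 2], hence [a = 1], which is the
    case [aabb] of [three_block_obstruction]. *)
Lemma periodic_defect_inner f e s i a (F := nth false f) :
  0 < e <= 2 -> 1 < s -> 0 < a -> i + e <= s ->
  i + a * s + e + 2 * s <= size f ->
  (forall k, k + s < size f -> F (k + s) = F k (+) ind (i + a * s) e k) ->
  (e = 2 -> F i != F i.+1) -> ~ tilde_isometric f.
Proof.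
move=> he hs a0 hi hn H si iso.
have hes : e <= s by clear -hi; lia.
(* The overlap contains position [i + s] and ends by [i + 2 * s], within the range of
   [hits_inner]. *)
have [l [q [nE l1 l2]]] : exists l q,
    [/\ size f = l + q * s, (i + s).+1 <= l & l < (i + s).+1 + s].
  by apply: shift_residue; [clear -hs|clear -hn he]; lia.
have aq : a < q.
  case: (mul_trichotomy a q s) => [[]|eq|[h1 h2]] //.
    by subst q; exfalso; clear -nE l2 hn he; lia.
  by exfalso; clear -nE l2 hn h1 h2 hs; lia.
have lt_as : s <= a * s by rewrite leq_pmull.
have Fs k : k <= i.+1 -> k + s < i + a * s + s -> F (k + s) = F k.
  move=> h1 h2; have := @shift_before F _ _ _ _ hes H 1 k.
  by rewrite mul1n; apply; [clear -h1 hn he hs lt_as; lia|].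
have [e' [h1 h2 h3 h4]] : exists e', [/\ 0 < e' <= 2, i + s + e' <= l,
    e' <= e & e' = e \/ i + s + e' = l].
  have [h|h] := leqP (i + s + e) l; first by exists e; split=> //; left.
  by exists 1; split; [| |clear -he; lia|right; clear -h l1 he; lia] => //; clear -l1; lia.
have := @overlap_two_errors f i e (i + s) e' (q * s).
rewrite -/F; case.
- by rewrite muln_gt0; clear -aq hs; lia.
- by [].
- by [].
- by clear -hi; lia.
- by rewrite nE; clear -h2; lia.
- move=> k hk; rewrite (shift_iter hes H) // hits_inner // ?a0 //; last first.
    by clear -hk nE l2; lia.
  rewrite addbA; congr addb; case: h4 => [->//|h4].
  rewrite /ind; clear -h4 h3 hk nE; lia.
- exact: si.
- move=> e2; have e2' : e = 2 by clear -e2 h3 he; lia.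
  rewrite Fs // ?leqnSn //; last by clear -hi lt_as a0 hs e2'; lia.
  rewrite -addSn Fs //; first exact: si.
  by clear -hi lt_as a0 hs e2'; lia.
- have [g|g] := ltnP (i + e) (i + s); first by constructor 1.
  have [e2 s2] : e = 2 /\ s = 2 by clear -he hs g; lia.
  len12 e'; last by constructor 2.
  constructor 3; split=> //.
  have -> : i.+2 = i + s by clear -s2; lia.
  rewrite Fs ?leqnSn //; last by clear -hs lt_as; lia.
  by rewrite eq_sym si.
- by [].
move=> ee' qe _.
have q2 : q = 2.
  apply/eqP; rewrite -(@eqn_pmul2r s); last by clear -hs; lia.
  by rewrite qe; apply/eqP; clear; lia.
have a1 : a = 1 by clear -q2 a0 aq; lia.
subst a q; apply: (three_block_obstruction he hs hi) iso => //.
- by clear -nE l2 hn; lia.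
- by move=> k hk; rewrite [LHS]H // mul1n.
Qed.

(** The errors start at [0] and [s - 1], so the outcome of [overlap_two_errors] would be a shift of
    [2 * (s - 1)]; but the shift is [q * s] with [q >= 3]. *)
Lemma periodic_defect_wrap f s a (F := nth false f) : 2 < s -> 0 < a ->
  s - 1 + a * s + 2 + 2 * s <= size f ->
  (forall k, k + s < size f -> F (k + s) = F k (+) ind (s - 1 + a * s) 2 k) ->
  F (s - 1) != F s -> ~ tilde_isometric f.
Proof.
move=> s3 a0 hn H si iso.
have hs : 1 < s by apply: ltnW.
have a1s : a.+1 * s = a * s + s by rewrite mulSnr.
have [l [q [nE l1 l2]]] : exists l q,
    [/\ size f = l + q * s, s <= l & l < s + s].
  by apply: shift_residue; [clear -hs|clear -hn]; lia.
have aq : a.+1 < q.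
  case: (mul_trichotomy a.+1 q s) => [[]|eq|[h1 h2]] //.
    by subst q; exfalso; clear -nE l2 hn a1s hs; lia.
  by exfalso; clear -nE l2 hn h1 h2 hs a1s; lia.
have [e' [h1 h2 h4]] : exists e',
    [/\ 0 < e' <= 2, s - 1 + e' <= l & e' = 2 \/ s - 1 + e' = l].
  have [h|h] := leqP (s - 1 + 2) l; first by exists 2; split=> //; left.
  by exists 1; split=> //; [|right]; clear -h l1 hs; lia.
have := @overlap_two_errors f 0 1 (s - 1) e' (q * s).
rewrite -/F; case.
- by rewrite muln_gt0; clear -aq hs; lia.
- by [].
- by [].
- by clear -s3; lia.
- by rewrite nE; clear -h2; lia.
- move=> k hk; rewrite (shift_iter hs H) // hits_wrap //; last first.
    by clear -hk nE l2; lia.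
  rewrite addbA; congr addb; case: h4 => [->//|h4].
  by rewrite /ind; clear -h4 h1 hk nE; lia.
- by [].
- by move=> _; rewrite (_ : (s - 1).+1 = s) //; clear -s3; lia.
- by constructor 1; clear -s3; lia.
- by [].
move=> ee' qe _.
have : 3 * s <= q * s by rewrite leq_mul2r; clear -aq a0; lia.
by rewrite qe; clear -s3; lia.
Qed.

Lemma hits_alternating a q k : 0 < a -> a.+1 < q -> k < 4 ->
  hits (1 + a * 2) 2 2 q k = ind 0 2 k (+) ind 2 2 k.
Proof.
move=> a0 aq hk; rewrite (_ : _ (+) _ = true).
  (* The block [1 + 2a], [2 + 2a] is reached in [a] steps from 1 and 2, in one step more from 0 and
     in one step less from 3. *)
  apply/hitsP; exists (a + (k == 0) - (k == 3)); first by case: eqP; lia.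
  by case: indP => //; do 2 case: eqP; lia.
by do 2 (case: indP => //); lia.
Qed.

(** Every position below 4 is hit, so a swap at 0 is followed at once by an error at 2. The outcome
    of [overlap_two_errors] would be [l = 4] and [q = 2], hence length 8, which is too short. *)
Lemma periodic_defect_alternating f a (F := nth false f) : 0 < a ->
  1 + a * 2 + 6 <= size f ->
  (forall k, k + 2 < size f -> F (k + 2) = F k (+) ind (1 + a * 2) 2 k) ->
  F 1 != F 2 -> ~ tilde_isometric f.
Proof.
move=> a0 hn H si iso.
have F2 : F 2 = F 0.
  by rewrite (H 0); [case: indP => [|_]; [lia|rewrite addbF]|lia].
have F3 : F 3 = F 1.
  by rewrite (H 1); [case: indP => [|_]; [lia|rewrite addbF]|lia].
have [l [q [nE l1 l2]]] : exists l q,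
    [/\ size f = l + q * 2, 3 <= l & l < 3 + 2].
  by apply: shift_residue; clear -hn; lia.
have := @overlap_two_errors f 0 2 2 (l - 2) (q * 2).
rewrite -/F; case.
- by clear -nE l2 hn; lia.
- by [].
- by clear -l1 l2; lia.
- by [].
- by clear -nE l1; lia.
- move=> k hk; rewrite (shift_iter (leqnn 2) H) // hits_alternating //;
    [|clear -nE hn l2|clear -hk nE l2]; try lia.
  by rewrite addbA; congr addb; rewrite /ind; clear -hk nE l1 l2; lia.
- by rewrite -F2 eq_sym.
- by rewrite F3 eq_sym.
- have [el|el] : l = 3 \/ l = 4 by clear -l1 l2; lia.
    by constructor 3; rewrite el.
  by constructor 2; rewrite el.
- by [].
by move=> el qe _; clear -el qe nE hn a0; lia.
Qed.

(** Writing [j = i + a * s] with [i < s], the defect either stays inside a period or is a swap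
    straddling two periods; in the latter case [s = 2] is separate because the two errors touch. *)
Lemma periodic_defect f j e s (F := nth false f) :
  0 < e <= 2 -> 1 < s -> s <= j -> j + e + 2 * s <= size f ->
  (forall k, k + s < size f -> F (k + s) = F k (+) ind j e k) ->
  (e = 2 -> F j != F j.+1) -> ~ tilde_isometric f.
Proof.
move=> he hs hj hn H sj.
have hes : e <= s by clear -he hs; lia.
have ej : j = j %% s + j %/ s * s by rewrite addnC -divn_eq.
have a0 : 0 < j %/ s by rewrite divn_gt0 //; apply: ltnW.
have ls : j %% s < s by rewrite ltn_mod ltnW.
move: (j %% s) (j %/ s) ej a0 ls => i a ej a0 ls.
have Fs k q : k + q * s <= j.+1 -> F (k + q * s) = F k.
  by move=> h; apply: (shift_before hes H) => //; clear -h hn hs he; lia.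
have sia : e = 2 -> F i != F i.+1.
  move=> e2; rewrite -(Fs i a) -?ej // -(Fs i.+1 a) addSn -?ej //.
  exact: sj.
have [hi|hi] := leqP (i + e) s.
  by apply: (@periodic_defect_inner f e s i a) => //; rewrite -ej.
have [e2 i1] : e = 2 /\ i = s - 1 by clear -he ls hi; lia.
subst e i; have si : (s - 1).+1 = s by clear -hs; lia.
have [s3|s2] := ltnP 2 s.
  apply: (@periodic_defect_wrap f s a) => //; rewrite -?ej //.
  by rewrite -[X in _ != _ X]si; apply: sia.
have es : s = 2 by clear -s2 hs; lia.
subst s; apply: (@periodic_defect_alternating f a) => //; rewrite -?ej //.
  by clear -hn ej; lia.
exact: sia.
Qed.

(** * Conditions (1), (2) and (3) *)

Lemma overlap_not_isometric f i ei j ej r (F := nth false f) :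
  0 < r -> 0 < ei <= 2 -> 0 < ej <= 2 -> i + ei <= j -> j + ej + r <= size f ->
  (forall k, k + r < size f -> F (k + r) = F k (+) ind i ei k (+) ind j ej k) ->
  (ei = 2 -> F i != F i.+1) -> (ej = 2 -> F j != F j.+1) ->
  [\/ i + ei < j, ei = 2 /\ ej = 2 | [/\ ei = 2, ej = 1 & F i.+1 != F i.+2]] ->
  ~ tilde_isometric f.
Proof.
move=> hr hei hej hij hj H si sj sep iso.
have [e er per] := overlap_two_errors hr hei hej hij hj H si sj sep iso.
apply: (@periodic_defect f j ej (j - i)) iso => //; last by clear -hj er; lia.
  by clear -hij e hei sep; case: sep => [?|[? ?]|[? ? _]]; lia.
by clear; lia.
Qed.

Lemma run2_flip w v a b : run w [:: a; b] = Some v ->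
  uniq (flatten (map modified [:: a; b])) ->
  [/\ forall k, nth false v k = nth false w k (+) ind (op_pos a) (op_len a) k
        (+) ind (op_pos b) (op_len b) k,
      op_pos a + op_len a <= size w, op_pos b + op_len b <= size w,
      is_swap a -> nth false w (op_pos a) != nth false w (op_pos a).+1
    & is_swap b -> nth false w (op_pos b) != nth false w (op_pos b).+1].
Proof.
rewrite [run _ _]/=; case Ea: apply_op => [w1|//]; case Eb: apply_op => [w2|//] [<-].
move=> /uniq_modified2 dis.
have [z1 b1 n1 s1] := apply_op_flip Ea; have [_ b2 n2 s2] := apply_op_flip Eb.
split=> [k|||//|hb]; [by rewrite n2 n1|by []|by rewrite -z1|].
have lb : op_len b = 2 by rewrite /op_len hb.
have out k : op_pos b <= k <= (op_pos b).+1 -> nth false w1 k = nth false w k.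
  move=> hk; rewrite n1; case: indP; rewrite ?addbF //.
  by clear -hk dis lb; lia.
by rewrite -!out ?s2 //; clear; lia.
Qed.

Lemma has_overlap2_not_isometric f P : has_overlap2 f P ->
  (forall oi oj, P oi oj -> op_pos oi + op_len oi <= op_pos oj ->
     op_pos oi + op_len oi < op_pos oj \/ op_len oi = 2 /\ op_len oj = 2) ->
  ~ tilde_isometric f.
Proof.
case=> l [a [b [l1 l2 _ [T _ uq]]]] + HP.
have [hv ha hb sa sb] := run2_flip T uq.
have dis := uniq_modified2 uq.
have lf : l <= size f by clear -l2 l1; lia.
have szp : size (pre l f) = l by rewrite size_takel.
rewrite szp in ha hb.
have swE o : op_len o = 2 -> is_swap o by rewrite /op_len; case: is_swap.
have np k : k < l -> nth false (pre l f) k = nth false f k.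
  by move=> hk; rewrite nth_take.
have ns k : nth false (suf l f) k = nth false f (k + (size f - l)).
  by rewrite nth_drop addnC.
have main oi oj : P oi oj -> op_pos oi + op_len oi <= op_pos oj ->
    op_pos oj + op_len oj <= l ->
    (forall k, nth false (suf l f) k = nth false (pre l f) k
       (+) ind (op_pos oi) (op_len oi) k (+) ind (op_pos oj) (op_len oj) k) ->
    (is_swap oi -> nth false (pre l f) (op_pos oi) != nth false (pre l f) (op_pos oi).+1) ->
    (is_swap oj -> nth false (pre l f) (op_pos oj) != nth false (pre l f) (op_pos oj).+1) ->
    ~ tilde_isometric f.
  move=> hP hij hj H si sj.
  have bi := op_len_bound oi; have bj := op_len_bound oj.
  apply: (@overlap_not_isometric f (op_pos oi) (op_len oi) (op_pos oj) (op_len oj)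
    (size f - l)) => //.
  - by clear -l1 l2; lia.
  - by clear -hj lf; lia.
  - by move=> k hk; rewrite -ns H np //; clear -hk; lia.
  - move=> e; move: (si (swE _ e)); rewrite !np //; clear -e hij hj bj; lia.
  - move=> e; move: (sj (swE _ e)); rewrite !np //; clear -e hij hj bj; lia.
  - by case: (HP _ _ hP hij) => h; [constructor 1|constructor 2].
rewrite /sort2; case: ltnP => lab /= hP; apply: (main _ _ hP) => //.
- have bb := op_len_bound b; clear -lab dis bb; lia.
- have ba := op_len_bound a; clear -lab dis ba; lia.
- by move=> k; rewrite hv addbAC.
Qed.

Lemma cond12_not_isometric f : cond1 f \/ cond2 f -> ~ tilde_isometric f.
Proof.
case=> [h|h]; apply: (has_overlap2_not_isometric h) => oi oj.
  by rewrite /adjacent /op_len; case: (is_swap oi); case: (is_swap oj); lia.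
by case/and3P; rewrite /op_len => -> ->; right.
Qed.

(** A swap at [size w2] and a replacement two positions later turn [101] into [010]. The last two
    letters of [101] differ, as the third alternative of [overlap_not_isometric] demands. *)
Lemma cond3_not_isometric f : cond3 f -> ~ tilde_isometric f.
Proof.
case=> w1 [w2 [w3 [w4 [n1 [e1 e2]]]]].
have s1 : 0 < size w1 by case: (w1) n1.
pose h := size w2.
have sz : size f = h + 3 + size w3 + size w1.
  by rewrite e2 !size_cat /= /h; clear; lia.
have g1 k : k < h -> nth false f (k + size w1) = nth false f k.
  move=> hk; rewrite {1}e2 e1 nth_cat ltnNge leq_addl addnK.
  by rewrite !nth_cat hk.
have g2 k : nth false f (h + k + size w1) = nth false ([:: false; true; false] ++ w3) k.
  rewrite e2 nth_cat ltnNge leq_addl addnK.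
  by rewrite nth_cat ltnNge leq_addr addKn.
have g3 k : nth false f (h + k) = nth false ([:: true; false; true] ++ w3 ++ w4) k.
  by rewrite e1 nth_cat ltnNge leq_addr addKn.
have f0 := g3 0; have f1 := g3 1; have f2 := g3 2.
rewrite /= addn0 in f0 f1 f2; rewrite addn1 in f1; rewrite addn2 in f2.
apply: (@overlap_not_isometric f h 2 (h + 2) 1 (size w1)) => //.
- by rewrite sz; clear; lia.
- move=> k hk; have [kh|kh] := ltnP k h.
    by rewrite g1 // !ind_lt ?addbF //; clear -kh; lia.
  have [k' ek hk'] : exists2 k', k = h + k' & k' < 3 + size w3.
    by exists (k - h); clear -sz hk kh; lia.
  have h0 : ind h 2 (h + k') = ind 0 2 k' by rewrite -{1}[h]addn0 ind_shift.
  rewrite ek g2 g3 h0 ind_shift.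
  case: k' {k hk kh ek h0} hk' => [|[|[|k]]] //= hk.
  by rewrite nth_cat !ind_gt ?addbF; [case: ltnP|..]; move: hk; clear; lia.
- by move=> _; rewrite f0 f1.
- by constructor 3; rewrite f1 f2.
Qed.

(** * Condition (4) *)

Lemma cond4_source_free h r p : p <= r -> 0 < r ->
  (forall k, k < h + 3 -> ind (h + 2 + r) 1 (k + p) (+) ind h 2 (k + p) =
     ind (h + 2 + r) 1 (k + r) (+) ind h 2 k) -> False.
Proof.
move=> hp hr H.
have [l0 l1 l2] : [/\ h < h + 3, h.+1 < h + 3 & h.+2 < h + 3] by clear; split; lia.
move: (H _ l0) (H _ l1) (H _ l2); clear H l0 l1 l2.
by ind_lia.
Qed.

Lemma cond4_target_shift h r p : p <= r -> 0 < r ->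
  (forall k, k < h + 3 -> ind (h + r) 2 (k + p) (+) ind (h + 2) 2 (k + p) =
     ind (h + r) 2 (k + r) (+) ind (h + 2) 2 k) ->
  p = 2 /\ r - p = 2 \/ p = 3 /\ h = 0 /\ r - p = 1.
Proof.
move=> hp hr H.
have [l0 l1 l2 l3] : [/\ h < h + 3, h.+1 < h + 3, h.+2 < h + 3 & h.-1 < h + 3].
  by clear; split; lia.
move: (H _ l0) (H _ l1) (H _ l2) (H _ l3); clear H l0 l1 l2 l3.
by ind_lia.
Qed.

(** Two swaps lead from [yx0101z] to [yx1010z]. The first one alone gives [yx1001z], which ends with
    [f]; the second one alone gives [yx0110z], which begins with [f = yx011]. *)
Lemma cond4_not_isometric f : cond4 f -> ~ tilde_isometric f.
Proof.
case=> [x [y [z [e1 e2]]]].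
pose h := size x; pose r := size y.
have sz1 : size f = h + 4 + size z by rewrite e1 !size_cat addnA.
have sz2 : size f = h + 3 + r by rewrite e2 !size_cat /= /h /r; clear; lia.
have r0 : 0 < r by clear -sz1 sz2; lia.
pose W := nth false (y ++ f).
have Wr k : W (r + k) = nth false f k by rewrite /W nth_cat ltnNge leq_addr addKn.
have W0 k : k < size f -> W k = nth false f k (+) ind (r + h) 3 k.
  rewrite /W => hk.
  have [lk|lk] := ltnP k r.
    by rewrite e2 !nth_cat lk ind_lt ?addbF //; clear -lk; lia.
  have [k' ek hk'] : exists2 k', k = r + k' & k' < h + 3.
    by exists (k - r); clear -lk hk sz2; lia.
  rewrite ek ind_shift [LHS]Wr {1}e1 e2 [nth _ _ (r + _)]nth_cat ltnNge leq_addr addKn.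
  rewrite !nth_cat -/h; have [lk'|lk'] := ltnP k' h.
    by rewrite ind_lt ?addbF.
  have [k2 ek2 hk2] : exists2 k2, k' = h + k2 & k2 < 3.
    by exists (k' - h); clear -hk' lk'; lia.
  have h0 : ind h 3 (h + k2) = ind 0 3 k2 by rewrite -{1}[h]addn0 ind_shift.
  rewrite ek2 addKn h0.
  by case: k2 {ek2 h0} hk2 => [|[|[|]]].
have fh k : nth false f (h + k) = nth false ([:: true; false; false; true] ++ z) k.
  by rewrite e1 nth_cat ltnNge leq_addr addKn.
have f0 := fh 0; have f1 := fh 1; have f2 := fh 2; have f3 := fh 3.
rewrite /= in f0 f1 f2 f3.
have f0' : nth false f h = true by rewrite -{1}[h]addn0.
have f1' : nth false f h.+1 = false by rewrite -addn1.
pose U k := W k (+) ind (r + h) 2 k.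
pose V k := W k (+) ind (r + (h + 2)) 2 k.
have U0 k : k < size f -> U k = nth false f k (+) ind (h + 2 + r) 1 k.
  move=> hk; rewrite /U W0 // -addbA; congr addb.
  by clear; do 3 (case: indP => //); lia.
have Ur k : k < size f -> U (r + k) = nth false f k (+) ind h 2 k.
  by move=> hk; rewrite /U Wr ind_shift.
have V0 k : k < size f -> V k = nth false f k (+) ind (h + r) 2 k.
  move=> hk; rewrite /V W0 // -addbA; congr addb.
  by clear -hk sz2; do 3 (case: indP => //); lia.
have Vr k : k < size f -> V (r + k) = nth false f k (+) ind (h + 2) 2 k.
  by move=> hk; rewrite /V Wr ind_shift.
have Hl k : k < h + 3 -> k + r < size f by rewrite sz2; clear; lia.
apply: (@two_block_obstruction f (mkseq U (r + size f)) (mkseq V (r + size f))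
    (r + h) 2 (r + (h + 2)) 2 r 0); rewrite ?size_mkseq //.
- by clear -r0; lia.
- by clear; lia.
- by clear -sz1; lia.
- apply: nth_mkseq_flip => [||k]; [by clear -sz1; lia..|].
  by rewrite /U /V addbK.
- move=> _; rewrite !nth_mkseq; [|clear -sz1; lia..].
  have hm : h.+1 < size f by rewrite sz1; clear; lia.
  rewrite -addnS !Ur ?f0' ?f1' //; last by apply: ltnW.
  by do 2 (case: indP => //); clear; lia.
- move=> _; rewrite !nth_mkseq; [|clear -sz1; lia..].
  rewrite -!addnS !Ur ?fh //; [|rewrite sz1; clear; lia..].
  by rewrite !ind_gt //; clear; lia.
- by constructor 2.
- apply: ffree_mkseq => p hp Hp; have {}hp : p <= r by clear -hp; lia.
  have [_ _ C] := occurs_shift U0 Ur hp Hp.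
  by apply: (cond4_source_free hp r0) => k /Hl/C.
- apply: ffree_mkseq => p hp Hp; have {}hp : p <= r by clear -hp; lia.
  have [_ B C] := occurs_shift V0 Vr hp Hp.
  (* Both remaining shifts equate the first letter of [1001] with one of its zeros. *)
  case: (cond4_target_shift hp r0 (fun k hk => C k (Hl k hk))) => [[_ ep]|[_ [h0 ep]]].
    have := B h; rewrite ep f2 f0' => /(_ ltac:(rewrite sz1; clear; lia)).
    by rewrite ind_lt //; clear; lia.
  have := B h; rewrite ep f1 f0' => /(_ ltac:(rewrite sz1; clear; lia)).
  by rewrite ind_lt //; clear; lia.
- apply: occurs_mkseq_flip => // k hk.
  by rewrite /U addbK Wr.
- by clear; lia.
- apply: occurs_mkseq_flip => [|k hk]; first by clear; lia.
  rewrite add0n /U W0 // -!addbA -[RHS]addbF; congr addb.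
  by clear -hk sz2; do 3 (case: indP => //); lia.
Qed.

(** * Condition (5) *)

Lemma cond5_source_free n p : 4 <= n -> p <= n - 2 ->
  (forall k, k < 2 -> ind (n - 1) 1 (k + p) (+) ind 0 1 (k + p) =
     ind (n - 1) 1 (k + (n - 2)) (+) ind 0 1 k) -> False.
Proof. by move=> hn hp H; move: (H 0 isT) (H 1 isT); clear H; ind_lia. Qed.

Lemma cond5_target_shift n p : 4 <= n -> n <> 5 -> p <= n - 2 ->
  (forall k, k < 2 -> ind (n - 3) 2 (k + p) (+) ind 1 2 (k + p) =
     ind (n - 3) 2 (k + (n - 2)) (+) ind 1 2 k) ->
  p = n - 3 \/ p = 1 \/ p = 2 /\ n = 6.
Proof. by move=> hn n5 hp H; move: (H 0 isT) (H 1 isT); clear H; ind_lia. Qed.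

(** Two swaps lead from [L1010R] to [L0101R]. The first one alone gives [L0110R], which ends with
    [f = 110R]; the second one alone gives [L1001R], which begins with [f = L100]. *)
Lemma cond5_not_isometric f : cond5 f -> ~ tilde_isometric f.
Proof.
case=> /prefixP[s2 e2] /suffixP[s1 e1].
pose F := nth false f.
have [n nE] : exists n, size f = n by exists (size f).
have n1 : n = size s1 + 3 by rewrite -nE e1 size_cat.
have [F0 F1 F2] : [/\ F 0 = true, F 1 = true & F 2 = false] by rewrite /F e2.
have Fe k : F (size s1 + k) = nth false [:: true; false; false] k.
  by rewrite /F e1 nth_cat ltnNge leq_addr addKn.
have G0 : F (n - 3) = true by rewrite n1 addnK -[size s1]addn0 Fe.
have G1 : F (n - 2) = false by rewrite n1 -addnBA // Fe.
have G2 : F (n - 1) = false by rewrite n1 -addnBA // Fe.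
have n4 : 4 <= n.
  have : n != 3 by apply/eqP => e; move: G1; rewrite e F1.
  by clear -n1; lia.
(* In length 5 the last letter of the prefix [110] would be the first letter of the suffix [100]. *)
have n5 : n <> 5 by move=> e; move: G0; rewrite e F2.
have [r rE] : exists r, r = n - 2 by exists (n - 2).
have r0 : 0 < r by clear -n4 rE; lia.
(* [W] is [L0110R]: the word [L], a [0] at position [n - 3], and [f] from [r = n - 2] on. *)
pose W k := if k < n - 3 then F k else if k == n - 3 then false else F (k - r).
have Wr k : W (r + k) = F k.
  rewrite /W.
  have -> : (r + k < n - 3) = false by clear -n4 rE; lia.
  have -> : (r + k == n - 3) = false by clear -n4 rE; lia.
  by rewrite addKn.
have W0 k : k < n -> W k = F k (+) ind (n - 3) 3 k.
  move=> hk; rewrite /W; case: ltnP => lk; first by rewrite ind_lt ?addbF.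
  have [->|[->|->]] : k = n - 3 \/ k = n - 2 \/ k = n - 1 by clear -hk lk; lia.
  - by rewrite eqxx G0; case: indP => //; clear; lia.
  - have -> : (n - 2 == n - 3) = false by clear -n4; lia.
    rewrite -{1}rE -rE subnn F0 rE G1.
    by case: indP => //; clear; lia.
  - have -> : (n - 1 == n - 3) = false by clear -n4; lia.
    rewrite G2.
    rewrite (_ : n - 1 - r = 1) ?F1; last by clear -n4 rE; lia.
    by case: indP => //; clear -n4; lia.
pose U k := W k (+) ind (n - 3) 2 k.
pose V k := W k (+) ind (n - 1) 2 k.
have U0 k : k < n -> U k = F k (+) ind (n - 1) 1 k.
  move=> hk; rewrite /U W0 // -addbA; congr addb.
  by clear -n4; do 3 (case: indP => //); lia.
have Ur k : k < n -> U (r + k) = F k (+) ind 0 1 k.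
  move=> hk; rewrite /U Wr; congr addb.
  by clear -n4 rE; do 2 (case: indP => //); lia.
have V0 k : k < n -> V k = F k (+) ind (n - 3) 2 k.
  move=> hk; rewrite /V W0 // -addbA; congr addb.
  by clear -hk n4; do 3 (case: indP => //); lia.
have Vr k : k < n -> V (r + k) = F k (+) ind 1 2 k.
  move=> hk; rewrite /V Wr; congr addb.
  by clear -n4 rE; do 2 (case: indP => //); lia.
have Hl k : k < 2 -> k + r < n by clear -n4 rE; lia.
apply: (@two_block_obstruction f (mkseq U (r + n)) (mkseq V (r + n))
    (n - 3) 2 (n - 1) 2 r 0); rewrite ?size_mkseq ?nE //.
- by clear -r0; lia.
- by clear -n4; lia.
- by clear -n4 rE; lia.
- apply: nth_mkseq_flip => [||k]; [by clear -n4 rE; lia..|].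
  by rewrite /U /V addbK.
- move=> _; rewrite !nth_mkseq; [|clear -n4 rE; lia..].
  have -> : (n - 3).+1 = n - 2 by clear -n4; lia.
  rewrite !U0 ?G0 ?G1; [|clear -n4; lia..].
  by rewrite !ind_lt //; clear -n4; lia.
- move=> _; rewrite !nth_mkseq; [|clear -n4 rE; lia..].
  have -> : (n - 1).+1 = r + 2 by clear -n4 rE; lia.
  have -> : n - 1 = r + 1 by clear -n4 rE; lia.
  rewrite !Ur ?F1 ?F2; [|clear -n4; lia..].
  by rewrite !ind_gt.
- by constructor 2.
- apply: ffree_mkseq => p hp Hp; have {}hp : p <= r by clear -hp nE; lia.
  have U0' : forall k, k < size f -> U k = F k (+) ind (n - 1) 1 k by rewrite nE.
  have Ur' : forall k, k < size f -> U (r + k) = F k (+) ind 0 1 k by rewrite nE.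
  have [_ _ C] := occurs_shift U0' Ur' hp Hp.
  rewrite nE in C; rewrite rE in hp C Hl.
  by apply: (cond5_source_free n4 hp) => k /Hl/C.
- apply: ffree_mkseq => p hp Hp; have {}hp : p <= r by clear -hp nE; lia.
  have V0' : forall k, k < size f -> V k = F k (+) ind (n - 3) 2 k by rewrite nE.
  have Vr' : forall k, k < size f -> V (r + k) = F k (+) ind 1 2 k by rewrite nE.
  have [A B C] := occurs_shift V0' Vr' hp Hp.
  rewrite nE -/F in A B C; rewrite rE in hp B C Hl.
  case: (cond5_target_shift n4 n5 hp (fun k hk => C k (Hl k hk))) => [ep|[ep|[ep n6]]].
  + have rp : n - 2 - p = 1 by rewrite ep; clear -n4; lia.
    have := B (n - 3); rewrite rp (_ : n - 3 + 1 = n - 2); last by clear -n4; lia.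
    rewrite G0 G1 => /(_ ltac:(clear -n4; lia)).
    case: indP => // _ h _; have n4' : n = 4 by clear -n4 n5 h; lia.
    have := B 2; rewrite rp F2 -[2 + 1]/(4 - 1) -[in F (4 - 1)]n4' G2 n4'.
    by move/(_ isT).
  + have := A 1; rewrite ep F1 F2 => /(_ ltac:(clear -n4; lia)).
    case: indP => // h _ _; have n4' : n = 4 by clear -n4 n5 h; lia.
    by have := A 0; rewrite ep F0 F1 n4' => /(_ isT).
  + by have := A 0; rewrite ep F0 F2 n6 => /(_ isT).
- by apply: occurs_mkseq_flip => [|k hk]; rewrite ?nE // /U addbK Wr.
- by clear; lia.
- apply: occurs_mkseq_flip => [|k hk]; first by rewrite nE leq_addl.
  rewrite add0n U0 -?nE // -addbA -[RHS]addbF; congr addb.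
  by clear -hk nE n4; do 2 (case: indP => //); lia.
Qed.

Lemma some_cond_not_isometric f : some_cond f -> ~ tilde_isometric f.
Proof.
case=> [h|[h|[h|[h|h]]]].
- by apply: cond12_not_isometric; left.
- by apply: cond12_not_isometric; right.
- exact: cond3_not_isometric.
- exact: cond4_not_isometric.
- exact: cond5_not_isometric.
Qed.

(** * Invariance under complement and reversal *)

Lemma run_bounds w v ops : run w ops = Some v ->
  all (fun o => op_pos o + op_len o <= size w) ops.
Proof.
elim: ops w => //= o os IH w; case E: apply_op => [w'|//] R.
by have [z b _ _] := apply_op_flip E; rewrite b -z (IH w').
Qed.

(** A minimal transformation from [sg u] to [sg v] through [f]-free words is carried back by the
    involution [sg], with [tau] translating its operations. Every transformation from [u] to [v] is
    carried over in the same way, so minimality is preserved. *)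
Lemma tilde_isometric_symmetry (sg : word -> word) (tau : nat -> op -> op) f :
  involutive sg -> (forall w, size (sg w) = size w) ->
  (forall x w, infix (sg x) (sg w) = infix x w) ->
  (forall w o w', apply_op w o = Some w' ->
     apply_op (sg w) (tau (size w) o) = Some (sg w')) ->
  (forall m ops, all (fun o => op_pos o + op_len o <= m) ops ->
     uniq (flatten (map modified ops)) ->
     uniq (flatten (map modified (map (tau m) ops)))) ->
  tilde_isometric f -> tilde_isometric (sg f).
Proof.
move=> sgK ssz sinf sop sun iso m hm u v hu hv fu fv.
have R w x ops : run w ops = Some x ->
    run (sg w) (map (tau (size w)) ops) = Some (sg x) /\
    trace (sg w) (map (tau (size w)) ops) = map sg (trace w ops).
  elim: ops w => [|o os IH] w /=; first by case=> ->.
  case E: apply_op => [w'|//] /IH; rewrite (sop _ _ _ E).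
  by have [-> _ _ _] := apply_op_flip E; case=> -> ->.
have fE w : ffree f (sg w) = ffree (sg f) w by rewrite /ffree -sinf sgK.
have [|||||ops [[T [_ min] uq] fr]] := iso m _ (sg u) (sg v).
- by rewrite -ssz.
- by rewrite ssz.
- by rewrite ssz.
- by rewrite fE.
- by rewrite fE.
have [T' tr] := R _ _ _ T; rewrite !sgK ssz in T' tr.
exists (map (tau (size u)) ops); split; last first.
  rewrite tr all_map; apply: sub_all fr => w /=.
  by rewrite -fE sgK.
split=> //.
- split; first by exists (map (tau (size u)) ops).
  move=> ops' /R[T2 _]; rewrite size_map.
  by rewrite -[size ops'](size_map (tau (size u))); apply: min.
- by apply: sun => //; have := run_bounds T; rewrite ssz.
Qed.

Lemma tilde_isometric_compl f : tilde_isometric f -> tilde_isometric (wcompl f).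
Proof.
apply: (@tilde_isometric_symmetry _ (fun _ o => o)).
- by move=> w; apply: mapK; apply: negbK.
- by move=> w; rewrite size_map.
- have inf x w : infix x w -> infix (wcompl x) (wcompl w).
    case/infixP=> a [b ->]; apply/infixP.
    by exists (wcompl a), (wcompl b); rewrite /wcompl !map_cat.
  move=> x w; apply/idP/idP => /inf //.
  by rewrite /wcompl !(mapK negbK).
- move=> w o w' E; have [z b n s] := apply_op_flip E.
  rewrite /wcompl.
  have := @apply_mkop (map negb w) (op_pos o) (op_len o) (op_len_bound o).
  have -> : mkop (op_pos o) (op_len o) = o by case: (o).
  rewrite size_map => /(_ b) [|x -> [zx nx]].
    move=> e; have h : is_swap o by move: e; rewrite /op_len; case: is_swap.
    rewrite !(nth_map false) ?(inj_eq negb_inj) ?s //; clear -b e; lia.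
  congr Some; apply: (@eq_from_nth _ false); first by rewrite zx size_map z.
  move=> k hk; rewrite zx in hk.
  by rewrite nx !(nth_map false) ?z // n addNb.
- by move=> m ops _; rewrite map_id.
Qed.

(** A swap is indexed by its left position, which after reversal is the image of [i.+1]; hence
    [m - i.+2]. *)
Definition rev_op (m : nat) (o : op) : op :=
  match o with Rep i => Rep (m - i.+1) | Swp i => Swp (m - i.+2) end.

Lemma tilde_isometric_rev f : tilde_isometric f -> tilde_isometric (wrev f).
Proof.
apply: (@tilde_isometric_symmetry _ rev_op).
- exact: revK.
- exact: size_rev.
- exact: infix_rev.
- move=> w o w' E; have [z b n s] := apply_op_flip E.
  have lr : op_len (rev_op (size w) o) = op_len o by case: (o).
  have pr : op_pos (rev_op (size w) o) = size w - (op_pos o + op_len o).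
    by case: (o) => i; rewrite /op_len /= ?addn1 ?addn2.
  rewrite /wrev.
  have := @apply_mkop (rev w) (op_pos (rev_op (size w) o)) (op_len o) (op_len_bound o).
  have -> : mkop (op_pos (rev_op (size w) o)) (op_len o) = rev_op (size w) o by case: (o).
  rewrite pr size_rev => /(_ ltac:(clear -b; lia)) [|x -> [zx nx]].
    move=> e; have h : is_swap o by move: e; rewrite /op_len; case: is_swap.
    rewrite !nth_rev; [|clear -b e; lia..].
    rewrite e in b *.
    have -> : size w - (size w - (op_pos o + 2)).+1 = (op_pos o).+1 by clear -b; lia.
    have -> : size w - (size w - (op_pos o + 2)).+2 = op_pos o by clear -b; lia.
    by rewrite eq_sym s.
  congr Some; apply: (@eq_from_nth _ false); first by rewrite zx size_rev z.
  move=> k hk; rewrite zx in hk.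
  rewrite nx !nth_rev ?z // n; congr addb.
  by clear -hk b; do 2 (case: indP => //); lia.
- move=> m ops hb uq.
  (* Reversal exchanges the two positions of each swap, so the lists agree only up to
     permutation. *)
  have P : perm_eq (flatten (map modified (map (rev_op m) ops)))
      (map (fun k => m - k.+1) (flatten (map modified ops))).
    elim: ops hb {uq} => //= o os IH /andP[ho /IH h].
    rewrite map_cat; apply: perm_cat h.
    case: o ho => i //=; rewrite /op_len /= => hi.
    have -> : (m - i.+2).+1 = m - i.+1 by clear -hi; lia.
    by rewrite (perm_catC [:: _] [:: _]).
  rewrite (perm_uniq P) map_inj_in_uniq //.
  have lt k : k \in flatten (map modified ops) -> k < m.
    elim: ops hb {uq P} => //= o os IH /andP[ho /IH h].
    rewrite mem_cat mem_modified => /orP[|/h//].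
    by case: indP => //; clear -ho; lia.
  by move=> x y /lt hx /lt hy; clear -hx hy; lia.
Qed.

Theorem theorem1 (f : word) :
  (some_cond f \/ some_cond (wrev f) \/ some_cond (wcompl f) \/
   some_cond (wrev (wcompl f))) ->
  ~ tilde_isometric f.
Proof.
case=> [|[|[|]]] /some_cond_not_isometric h iso; apply: h => //.
- exact: tilde_isometric_rev.
- exact: tilde_isometric_compl.
- exact/tilde_isometric_rev/tilde_isometric_compl.
Qed.
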